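(* Let $X$ be a graph on $n$ vertices. Then for $r=3,\dots,n$, the number $s_e(K_r,X)=s_v(K_r,X)$ is determined by the edge zeta function $\zeta_X(\vec u)$. In particular, the clique number $\omega(X)$ is determined by $\zeta_X(\vec u)$.
   Context: Graphs: A graph $X=(V,E)$ is a finite nonempty set $V$ of vertices and a finite multiset $E$ of unordered pairs of vertices, called edges. The symmetric digraph $D(X)$ has vertex set $V$ and, for each edge of $X$, two arcs (an arc $e$ and its inverse arc $\overline e$) on the same endpoints; an arc $e=(u,w)$ has origin $o(e)=u$ and terminus $t(e)=w$, and $\overline e=(w,u)$. Prime cycles: A cycle of length $n$ in $X$ is a sequence $c=(e_1,\dots,e_n)$ of arcs of $D(X)$ with $t(e_i)=o(e_{i+1})$ for $1\le i\le n-1$ and $t(e_n)=o(e_1)$. It has backtracking if $\overline{e_{i+1}}=e_i$ for some $1\le i\le n-1$, and has a tail if $e_1=\overline{e_n}$. It is primitive if it is not obtained by going $r\ge 2$ times around some other cycle. Two cycles are equivalent if they differ by a cyclic permutation (reversing direction is not an equivalence). A prime cycle $[c]$ is an equivalence class of primitive cycles with no backtracking and no tail. Edge zeta function: Associate to each arc $e$ of $D(X)$ a variable $u_e$, and put $g(c)=\prod_{e\text{ arc in }c}u_e$ (with multiplicity). The edge zeta function of $X$ is the function of the $u_e\in\mathbb C$ (sufficiently near $0$) given by $\zeta_X(\vec u)=\prod_{[c]}(1-g(c))^{-1}$, the product over all prime cycles; it is the reciprocal of a polynomial in the $2|E|$ variables $u_e$. Meaning of ''determined by $\zeta_X(\vec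 u)$'': it is assumed that the pairing of the variable of each arc with the variable of its inverse arc is given as part of the data. Thus a quantity $Q(X)$ is determined by $\zeta_X(\vec u)$ if, whenever $X$ and $X'$ both satisfy the hypotheses on $X$ (here: both are graphs on $n$ vertices) and there is a bijection $\varphi$ from the arcs of $D(X)$ to the arcs of $D(X')$ with $\varphi(\overline e)=\overline{\varphi(e)}$ under which $\zeta_X$ becomes $\zeta_{X'}$ (identifying $u_e$ with $u_{\varphi(e)}$), one has $Q(X)=Q(X')$. Subgraph counts: For $S\subseteq V$, the vertex-induced subgraph $\langle S\rangle$ has vertex set $S$ and all edges of $X$ with both endpoints in $S$. For $R\subseteq E$, the edge-induced subgraph $\langle R\rangle$ has edge set $R$ and as vertices all vertices incident to some edge of $R$. $s_v(W,X)$ (resp. $s_e(W,X)$) is the number of vertex-induced (resp. edge-induced) subgraphs of $X$ isomorphic to $W$. $K_r$ is the complete graph on $r$ vertices. The clique number $\omega(X)$ is the largest integer $r$ such that $X$ has a vertex-induced subgraph isomorphic to $K_r$.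
   Formalization: Equality s_e(K_r,X)=s_v(K_r,X) is stated only for simple X (it fails for a triangle with a doubled edge), though both numbers are shown determined for all multigraphs; the clique number is shown determined for loopless graphs only (it fails with loops). *)

(* Defs.v *)
(* MathComp / MathComp-Analysis world. *)
From HB Require Import structures.
From mathcomp Require Import all_boot all_order all_algebra.
From mathcomp Require Import all_classical all_reals all_analysis.
From mathcomp Require Export complex.
Set Implicit Arguments.
Unset Strict Implicit.
Unset Printing Implicit Defensive.

Import Order.TTheory GRing.Theory Num.Theory.
Import numFieldNormedType.Exports.
Local Open Scope ring_scope.

(* Finite multigraphs, loops and parallel edges allowed.  Edges are indexed by
   a finType, which makes them a multiset.  The orientation (src, tgt) only
   serves to name the two arcs of an edge (it is needed for loops): an edge is
   the unordered pair [ends e].  A vertex set is not required to be nonempty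
   here; nonemptiness is a hypothesis of the theorem. *)
Record mgraph := MGraph {
  vert : finType;
  edge : finType;
  src : edge -> vert;
  tgt : edge -> vert
}.

Definition ends (X : mgraph) (e : edge X) : {set vert X} := [set src e; tgt e].

Definition loopless (X : mgraph) : Prop := forall e : edge X, src e != tgt e.

(* Two pitfalls of multigraphs.  s_e and s_v (below) agree on simple graphs
   only: doubling an edge of a triangle gives s_e K_3 = 2 and s_v K_3 = 0.  The
   clique number is not determined once loops are allowed: on the vertices
   a, b, c, a loop at a together with either an edge ab or an edge bc gives the
   same edge zeta function, but clique numbers 1 and 2. *)
Definition simple_graph (X : mgraph) : Prop :=
  loopless X /\ injective (@ends X).

Definition giso (X Y : mgraph) : Prop :=
  exists (f : vert X -> vert Y) (h : edge X -> edge Y),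
    [/\ bijective f, bijective h & forall e, ends (h e) = f @: ends e].

(* (e, true) runs from src e to tgt e, and (e, false) from tgt e to src e. *)
Definition darc (X : mgraph) : finType := (edge X * bool)%type.

Definition orig (X : mgraph) (a : darc X) : vert X :=
  if a.2 then src a.1 else tgt a.1.

Definition term (X : mgraph) (a : darc X) : vert X :=
  if a.2 then tgt a.1 else src a.1.

Definition ainv (X : mgraph) (a : darc X) : darc X := (a.1, ~~ a.2).

Section Cycles.
Variable X : mgraph.
Implicit Types c d : seq (darc X).

Definition is_cycle c : bool :=
  (c != [::]) && cycle [rel a b | term a == orig b] c.

Definition backtrackless c : bool := sorted [rel a b | ainv b != a] c.

Definition tailless c : bool :=
  if c is a :: c' then a != ainv (last a c') else true.

Definition primitive c : Prop :=
  ~ exists d (r : nat), [/\ is_cycle d, (2 <= r)%N & c = flatten (nseq r d)].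

Definition is_prime_cycle c : Prop :=
  [/\ is_cycle c, backtrackless c, tailless c & primitive c].

Definition cyc_equiv c d : bool := [exists i : 'I_(size c).+1, d == rot i c].

Definition prime_tuples (k : nat) : {set k.-tuple (darc X)} :=
  [set c : k.-tuple (darc X) | `[< is_prime_cycle c >]].

(* The prime cycles [c] of length k, as equivalence classes. *)
Definition prime_cycles (k : nat) : {set {set k.-tuple (darc X)}} :=
  equivalence_partition
    (fun c d : k.-tuple (darc X) => cyc_equiv c d) (prime_tuples k).

End Cycles.

(* R[i], in a form from which its normed topology is inferred. *)
Definition Cplx (R : realType) : numFieldType := R[i].

Definition gmon (R : realType) (X : mgraph) (u : darc X -> Cplx R)
    (c : seq (darc X)) : Cplx R := \prod_(a <- c) u a.

(* The factors are grouped by length, with one representative c of each class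
   (gmon u is invariant under rotation); for u near 0 the infinite product
   converges absolutely, so that the order of the factors is immaterial. *)
Definition edge_zeta (R : realType) (X : mgraph) (u : darc X -> Cplx R)
    : Cplx R :=
  limn (fun N : nat =>
    \prod_(k < N)
      \prod_(c in transversal (prime_cycles X k) (prime_tuples X k))
        (1 - gmon u c)^-1).

Definition zeta_equiv (R : realType) (X X' : mgraph) : Prop :=
  exists phi : darc X -> darc X',
    [/\ bijective phi,
        forall a, phi (ainv a) = ainv (phi a) &
        exists2 eps : R, 0 < eps &
          forall u : darc X' -> Cplx R, (forall a, `|u a| < (eps%:C)%C) ->
            edge_zeta (u \o phi) = edge_zeta u].

(* The quantity Q is determined by the edge zeta function among the graphs
   satisfying H. *)
Definition zeta_determined (R : realType) (H : mgraph -> Prop) (T : Type)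
    (Q : mgraph -> T) : Prop :=
  forall X X' : mgraph, H X -> H X' -> zeta_equiv R X X' -> Q X = Q X'.

Section Subgraphs.
Variable X : mgraph.

Section Subgraph.
Variables (S : {set vert X}) (E : {set edge X}).
Hypothesis sub_ES : forall e, e \in E -> ends e \subset S.

Lemma subgraph_src (e : {e | e \in E}) : src (val e) \in S.
Proof. by apply: (fintype.subsetP (sub_ES (valP e))); rewrite !inE eqxx. Qed.

Lemma subgraph_tgt (e : {e | e \in E}) : tgt (val e) \in S.
Proof. by apply: (fintype.subsetP (sub_ES (valP e))); rewrite !inE eqxx orbT. Qed.

Definition subgraph : mgraph :=
  @MGraph {v | v \in S} {e | e \in E}
    (fun e => exist _ (src (val e)) (subgraph_src e))
    (fun e => exist _ (tgt (val e)) (subgraph_tgt e)).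

End Subgraph.

Lemma vinduced_sub (S : {set vert X}) (e : edge X) :
  e \in [set e' | ends e' \subset S] -> ends e \subset S.
Proof. by rewrite inE. Qed.

Definition vinduced (S : {set vert X}) : mgraph := subgraph (@vinduced_sub S).

Lemma einduced_sub (E : {set edge X}) (e : edge X) :
  e \in E -> ends e \subset \bigcup_(e' in E) ends e'.
Proof. exact: finset.bigcup_sup. Qed.

Definition einduced (E : {set edge X}) : mgraph := subgraph (@einduced_sub E).

End Subgraphs.

Definition s_v (W X : mgraph) : nat :=
  #|[set S : {set vert X} | `[< giso (vinduced S) W >]]|.

Definition s_e (W X : mgraph) : nat :=
  #|[set E : {set edge X} | `[< giso (einduced E) W >]]|.

Definition complete (r : nat) : mgraph :=
  @MGraph 'I_r {p : 'I_r * 'I_r | (p.1 < p.2)%N}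
    (fun p => (val p).1) (fun p => (val p).2).

(* An induced K_r uses r vertices, so r <= #|vert X| loses nothing.  The value
   is 0 if no induced subgraph is a K_r with r >= 1 (every vertex has a
   loop). *)
Definition clique_number (X : mgraph) : nat :=
  \max_(r < #|vert X|.+1 | (0 < s_v (complete r) X)%N) r.

(* Main.v *)
Require Import Defs.
From mathcomp Require Import all_boot all_order all_algebra.
From mathcomp Require Import all_classical all_reals all_analysis.
Import Order.TTheory GRing.Theory Num.Theory.
Import numFieldNormedType.Exports.
Import mathcomp.boot.fintype mathcomp.boot.finset.

(**
The edge zeta function is the product of the factors [1 / (1 - g(c))], and it is
evaluated here at points where the variables in a set [A] of arcs have a common
small value [t > 0] and all others vanish. Only the prime cycles inside [A]
contribute, each with a real factor larger than 1. Hence the value is 1 exactly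
if [A] contains no prime cycle, and, more generally, if [B] and [C] are disjoint
subsets of [A] that each contain finitely many prime cycles, the value at [A] is
the product of the values at [B] and [C] exactly if every prime cycle in [A]
lies in [B] or in [C] ([edge_zeta_split]). This property is therefore preserved
by a bijection of arcs that identifies two zeta functions ([splits_transfer]).

Small sets of arcs now give what is needed: the bijection preserves loops, pairs
of parallel edges ([match_digon]), triangles up to their sense of rotation
([match_triangle]), and whether a loop is attached to a given triangle
([match_loop_at]).

In a complete graph let [a x y] be the arc from [x] to [y]. The images [b x y] of
these arcs form triangles for any three [x], [y], [z], each of which runs either
in the order of [x], [y], [z] or in the opposite order. Two triangles with a common
edge must have the same sense, as otherwise a third triangle could not close up
([coherent_triangles]). So all have the same sense, and after inverting all arcs if
necessary the arcs [b x y] with a fixed [x] share their origin, which is the image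
of the vertex [x] ([common_vertices]). Thus edge sets of complete subgraphs go to
edge sets of complete subgraphs ([complete_on_transfer]), which gives [s_e].

A vertex-induced complete subgraph with at least two vertices is the same as an
edge set of this kind such that no other edge runs between its vertices. Such an
edge would be a parallel edge or an attached loop, and both are detected
([inside_transfer]). This gives [s_v]. Without loops the argument covers [K_2] too,
and as [K_0] and [K_1] then occur as soon as there are enough vertices, it gives the
clique number.
*)

Set Implicit Arguments.
Unset Strict Implicit.
Unset Printing Implicit Defensive.

(** * Closed walks and prime cycles *)

Section Cycles.
Variable X : mgraph.
Implicit Types (a b : darc X) (c d : seq (darc X)) (A B C : {set darc X}).

Lemma ainvK : involutive (@ainv X).
Proof. by case=> e b; rewrite /ainv /= negbK. Qed.

Lemma orig_ainv a : orig (ainv a) = term a.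
Proof. by case: a => e []. Qed.

Lemma term_ainv a : term (ainv a) = orig a.
Proof. by case: a => e []. Qed.

Lemma ends_darc a : ends a.1 = [set orig a; term a].
Proof. by case: a => e []; rewrite /ends //= setUC. Qed.

Lemma cycle_invariant (r : rel (darc X)) (P : pred (darc X)) c a :
    cycle r c -> a \in c -> P a ->
    {in c &, forall b b', P b -> r b b' -> P b'} ->
  all P c.
Proof.
move=> rc ac Pa step.
have [i p def_c] := rot_to ac.
suff: all P (rot i c) by move/allP=> h; apply/allP => x xc; apply: h; rewrite mem_rot.
rewrite def_c /= Pa /=.
have: path r a p by move: rc; rewrite -(rot_cycle i) def_c /= rcons_path => /andP[].
have: {subset a :: p <= c} by move=> b; rewrite -def_c mem_rot.
elim: p a Pa {ac def_c} => //= b p IHp a Pa sub /andP[rab rp].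
have Pb : P b by apply: step rab => //; apply: sub; rewrite !inE eqxx ?orbT.
by rewrite Pb (IHp b) // => x xp; apply: sub; rewrite inE xp orbT.
Qed.

(** The only source of prime cycles below: backtracking, a tail and a proper
    power would each make some edge occur twice. *)
Lemma uniq_edges_prime c :
  is_cycle c -> uniq [seq a.1 | a <- c] -> is_prime_cycle c.
Proof.
move=> cc uc; split=> //.
- case: c uc {cc} => //= a p; elim: p a => //= b p IHp a /andP[abp ubp].
  rewrite /= IHp // andbT; apply: contraNneq abp => <-.
  by rewrite inE eqxx.
- case: c uc {cc} => //= a p /andP[+ _].
  case/lastP: p => [|p b]; first by case: a => e [] _; rewrite xpair_eqE andbF.
  rewrite last_rcons; apply: contraNneq => ->.
  by rewrite map_rcons mem_rcons inE eqxx.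
- case=> d [[|[|r]] [/andP[d0 _] // _ def_c]].
  move: uc; rewrite def_c /= map_cat cat_uniq => /and3P[_ + _].
  case: d d0 {def_c} => // a d _ /hasPn/(_ a.1).
  by rewrite !map_cat mem_cat !inE /= !eqxx /= => /(_ isT).
Qed.

Lemma cycle_succ c a :
  is_cycle c -> a \in c -> exists2 b, b \in c & term a = orig b.
Proof.
move=> /andP[_ cc] ac; exists (next c a); first by rewrite mem_next.
exact/eqP/(next_cycle cc).
Qed.

Lemma prime_neq0 c : is_prime_cycle c -> c != [::].
Proof. by case=> /andP[]. Qed.

(** If the arcs of [A] have distinct origins, each arc has at most one successor
    in [A], so a closed walk in [A] is a number of turns around an orbit of the
    successor map; a primitive one is a single turn. *)
Lemma prime_size_le A c : {in A &, injective (@orig X)} ->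
  is_prime_cycle c -> {subset c <= A} -> (size c <= #|A|)%N.
Proof.
move=> injA [/andP[c0 cc] _ _ prim] cA.
(* Off the walk, [s] may fix an arc that has no successor in [A]. *)
pose s a := odflt a [pick b in A | term a == orig b].
have sE a b : b \in A -> term a = orig b -> s a = b.
  move=> bA ab; rewrite /s; case: pickP => [b' /andP[b'A /eqP ab']|/(_ b)] /=.
    by apply: injA => //; rewrite -ab -ab'.
  by rewrite bA ab eqxx.
have fc : fcycle s c.
  apply: (sub_in_cycle (P := mem c)) cc => [a b ac bc /= /eqP ab|]; last exact/allP.
  by apply/eqP/sE => //; apply: cA.
have adj_s a : a \in c -> term a == orig (s a).
  move=> ac; have [|b bc ab] := cycle_succ _ ac; first by rewrite /is_cycle c0.
  by rewrite (sE a b) // ?ab //; apply: cA.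
case: c c0 cc cA fc prim adj_s => // a p _ cc cA fc prim adj_s.
have [k def_c] := fcycle_consEflatten fc.
have sub_o : {subset fingraph.orbit s a <= a :: p}.
  by move=> b bo; rewrite def_c /= mem_cat bo.
case: k def_c => [|k] def_c.
  rewrite def_c /= cats0 -(card_uniqP (orbit_uniq s a)).
  by apply/subset_leq_card/subsetP => b /sub_o/cA.
(* At least two turns: the orbit itself contradicts primitivity. *)
case: prim; exists (fingraph.orbit s a), k.+2; split=> //.
rewrite /is_cycle -size_eq0 size_orbit -lt0n order_gt0 /=.
have fo : fcycle s (fingraph.orbit s a).
  by apply: (cycle_orbit_cycle fc); rewrite mem_head.
apply: (sub_in_cycle (P := mem (a :: p))) fo; last by apply/allP.
by move=> b b' /adj_s + _ /= /eqP <-.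
Qed.

Lemma cyc_equivP c d :
  reflect (exists2 i, (i <= size c)%N & d = rot i c) (cyc_equiv c d).
Proof.
apply: (iffP existsP) => [[i /eqP ->]|[i ile ->]].
  by exists i => //; rewrite -ltnS.
by exists (Ordinal (ile : (i < (size c).+1)%N)).
Qed.

Lemma cyc_equiv_refl c : cyc_equiv c c.
Proof. by apply/cyc_equivP; exists 0; rewrite ?rot0. Qed.

Lemma cyc_equiv_sym c d : cyc_equiv c d -> cyc_equiv d c.
Proof.
case/cyc_equivP=> i ile ->; apply/cyc_equivP; exists (size c - i)%N.
  by rewrite size_rot leq_subr.
by rewrite -{1}(rotK i c) /rotr size_rot.
Qed.

Lemma cyc_equiv_trans c d c' : cyc_equiv c d -> cyc_equiv d c' -> cyc_equiv c c'.
Proof.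
case/cyc_equivP=> i ile ->; case/cyc_equivP=> j; rewrite size_rot => jle ->.
apply/cyc_equivP; rewrite rot_add_mod //.
by case: ifP => h; eexists; try reflexivity; rewrite ?leq_subLR ?leq_add.
Qed.

Lemma cyc_equiv_mem c d : cyc_equiv c d -> c =i d.
Proof. by case/cyc_equivP=> i _ -> a; rewrite mem_rot. Qed.

Lemma cyc_equiv_equivalence k :
  {in prime_tuples X k & &,
    equivalence_rel (fun c d : k.-tuple (darc X) => cyc_equiv c d)}.
Proof.
move=> c d c' _ _ _; split; first exact: cyc_equiv_refl.
move=> cd; apply/idP/idP; last exact: cyc_equiv_trans.
by apply: cyc_equiv_trans; apply: cyc_equiv_sym.
Qed.

Lemma prime_cycles_partition k :
  partition (prime_cycles X k) (prime_tuples X k).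
Proof.
exact/equivalence_partitionP/cyc_equiv_equivalence.
Qed.

Definition prime_reps k := transversal (prime_cycles X k) (prime_tuples X k).

Lemma prime_repsP k (c : k.-tuple (darc X)) :
  c \in prime_reps k -> is_prime_cycle c.
Proof.
move/(fintype.subsetP (transversal_sub (transversalP (prime_cycles_partition k)))).
by rewrite inE => /asboolP.
Qed.

Lemma prime_has_rep c : is_prime_cycle c ->
  exists2 d : (size c).-tuple (darc X), d \in prime_reps (size c) & c =i d.
Proof.
move=> pc; pose D := prime_tuples X (size c); pose P := prime_cycles X (size c).
have part : partition P D := prime_cycles_partition _.
have cD : in_tuple c \in D by rewrite inE; apply/asboolP.
have tr := transversalP part.
pose B := pblock P (in_tuple c).
have BP : B \in P by rewrite pblock_mem // (cover_partition part).
exists (transversal_repr (in_tuple c) (prime_reps (size c)) B).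
  exact: (repr_mem_transversal tr).
have dB := repr_mem_pblock tr (in_tuple c) BP.
move: dB; rewrite /B pblock_equivalence_partition //.
- by move/cyc_equiv_mem.
- exact: cyc_equiv_equivalence.
- exact: (fintype.subsetP (transversal_sub tr) _ (repr_mem_transversal tr _ BP)).
Qed.
End Cycles.

(** * The zeta function at weights supported on a set of arcs *)

Section Zeta.
Local Open Scope ring_scope.
Variables (R : realType) (X : mgraph).
Implicit Types (c : seq (darc X)) (A B C : {set darc X}) (N : nat).

(** Setting the variables outside [A] to 0 removes from the product all prime
    cycles that leave [A]. *)
Definition weight (t : Cplx R) A (a : darc X) : Cplx R :=
  if a \in A then t else 0.

Definition partial_zeta (u : darc X -> Cplx R) N : Cplx R :=
  \prod_(k < N) \prod_(c in prime_reps X k) (1 - gmon u c)^-1.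

Lemma edge_zeta_lim u (v : Cplx R) N0 :
  (forall N, (N0 <= N)%N -> partial_zeta u N = v) -> edge_zeta u = v.
Proof.
move=> cst; apply: lim_near_cst; first exact: norm_hausdorff.
by exists N0 => // N /= ?; apply: cst.
Qed.

(** The lower bound on the partial products settles both cases: a limit would be
    at least [w], while the limit of a divergent sequence is 0 by convention,
    which is not [v] either. Hence no convergence estimate for the infinite
    product is needed. *)
Lemma edge_zeta_neq u (v w : Cplx R) N0 : 0 < v -> v < w ->
  (forall N, (N0 <= N)%N -> w <= partial_zeta u N) -> edge_zeta u <> v.
Proof.
move=> v_gt0 vw Pge.
case: (pselect (cvgn (partial_zeta u))) => [Pcvg Ev|/dvgP E0 Ev]; last first.
  by move: v_gt0; rewrite -Ev [edge_zeta u]E0 ltxx.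
have : (partial_zeta u @ \oo --> v)%classic by rewrite -Ev.
move/cvgrPdist_lt => /(_ (w - v)); rewrite subr_gt0 => /(_ vw) [N1 _ /(_ (maxn N0 N1))].
move=> /(_ (leq_maxr _ _)) /=.
have wP := Pge _ (leq_maxl N0 N1).
rewrite distrC ger0_norm ?subr_ge0 ?(le_trans (ltW vw)) // ltrD2r.
by move/(le_lt_trans wP); rewrite ltxx.
Qed.

Lemma gmon_weight t A c :
  gmon (weight t A) c = if all (mem A) c then t ^+ size c else 0.
Proof.
rewrite /gmon; elim: c => [|a c IHc]; first by rewrite big_nil.
rewrite big_cons IHc /= /weight; case: (a \in A); last by rewrite mul0r.
by case: ifP => _; rewrite ?mulr0 // exprS.
Qed.

Variable t : Cplx R.
Hypotheses (t_gt0 : 0 < t) (t_lt1 : t < 1).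

Lemma factor_gt1 c : c != [::] -> 1 < (1 - t ^+ size c)^-1.
Proof.
move=> c0; have tc : t ^+ size c < 1 by rewrite exprn_ilt1 ?ltW // size_eq0.
rewrite invf_gt1 ?subr_gt0 // gtrBl exprn_gt0 //.
Qed.

Lemma factor_ge1 A c : c != [::] -> 1 <= (1 - gmon (weight t A) c)^-1.
Proof.
move=> c0; rewrite gmon_weight; case: ifP => _; first exact/ltW/factor_gt1.
by rewrite subr0 invr1.
Qed.

Lemma partial_zeta_ge1 A N : 1 <= partial_zeta (weight t A) N.
Proof.
have ge1M (x y : Cplx R) : 1 <= x -> 1 <= y -> 1 <= x * y by apply: mulr_ege1.
apply: (big_ind (fun x : Cplx R => 1 <= x)) => // k _.
apply: (big_ind (fun x : Cplx R => 1 <= x)) => // c /prime_repsP pc.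
exact/factor_ge1/prime_neq0.
Qed.

(** By [prime_size_le], only finitely many prime cycles remain, so the product
    is finite. *)
Lemma partial_zeta_stationary A : {in A &, injective (@orig X)} ->
  forall N, (#|A| < N)%N -> partial_zeta (weight t A) N = edge_zeta (weight t A).
Proof.
move=> injA.
suff cst N : (#|A| < N)%N ->
    partial_zeta (weight t A) N = partial_zeta (weight t A) #|A|.+1.
  by move=> N ltAN; rewrite (edge_zeta_lim cst) cst.
move=> ltAN; rewrite /partial_zeta -!(big_mkord xpredT
   (fun k => \prod_(c in prime_reps X k) (1 - gmon (weight t A) c)^-1)).
rewrite (@big_cat_nat _ _ _ #|A|.+1) //= [X in _ * X]big_nat [X in _ * X]big1 ?mulr1 //.
move=> k /andP[ltAk _]; rewrite big1 // => c /prime_repsP pc.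
rewrite gmon_weight; case: ifP => [/allP cA|_]; last by rewrite subr0 invr1.
by have := prime_size_le injA pc cA; rewrite size_tuple leqNgt ltAk.
Qed.

Definition splits A B C := forall c, is_prime_cycle c ->
  {subset c <= A} -> {subset c <= B} \/ {subset c <= C}.

Section Split.
Variables A B C : {set darc X}.
Hypotheses (BA : B \subset A) (CA : C \subset A) (BC : [disjoint B & C]).

Let not_both c : is_prime_cycle c -> all (mem B) c -> all (mem C) c -> False.
Proof.
move=> /prime_neq0; case: c => // a c _ /andP[/= aB _] /andP[/= aC _].
by have := disjointFr BC aB; rewrite aC.
Qed.

Let sub_all (D : {set darc X}) c : D \subset A -> all (mem D) c -> all (mem A) c.
Proof. by move=> DA; apply: sub_all; apply/fintype.subsetP. Qed.

Let factor_ge c : is_prime_cycle c ->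
  (1 - gmon (weight t B) c)^-1 * (1 - gmon (weight t C) c)^-1
    <= (1 - gmon (weight t A) c)^-1.
Proof.
move=> pc; have := factor_ge1 A (prime_neq0 pc); rewrite !gmon_weight.
case: (boolP (all (mem B) c)) => [cB|_]; last rewrite subr0 invr1 mul1r.
  case: (boolP (all (mem C) c)) => [cC|_]; first by case: (not_both pc cB cC).
  by rewrite (sub_all BA cB) subr0 invr1 mulr1.
by case: (boolP (all (mem C) c)) => [cC|_]; rewrite ?(sub_all CA cC) ?subr0 ?invr1.
Qed.

Lemma partial_zeta_split : splits A B C -> forall N,
  partial_zeta (weight t A) N =
    partial_zeta (weight t B) N * partial_zeta (weight t C) N.
Proof.
move=> spl N; rewrite -big_split; apply: eq_bigr => k _; rewrite -big_split.
apply: eq_bigr => c /prime_repsP pc; rewrite /= !gmon_weight.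
case: (boolP (all (mem A) c)) => [/allP cA|cA].
  case: (spl _ pc cA) => /allP cD.
    have /negbTE-> : ~~ all (mem C) c by apply/negP; apply: not_both cD.
    by rewrite cD subr0 invr1 mulr1.
  have /negbTE-> : ~~ all (mem B) c by apply/negP => /(not_both pc)/(_ cD).
  by rewrite cD subr0 invr1 mul1r.
have /negbTE-> : ~~ all (mem B) c by apply: contra cA; apply: sub_all.
have /negbTE-> : ~~ all (mem C) c by apply: contra cA; apply: sub_all.
by rewrite subr0 invr1 mulr1.
Qed.

(** The factor of every prime cycle in [A] is at least the product of its factors
    for [B] and for [C], and the factor of [c] contributes in [A] only. *)
Lemma partial_zeta_nonsplit c : is_prime_cycle c -> {subset c <= A} ->
  ~ {subset c <= B} -> ~ {subset c <= C} -> forall N, (size c < N)%N ->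
  (1 - t ^+ size c)^-1 * (partial_zeta (weight t B) N * partial_zeta (weight t C) N)
    <= partial_zeta (weight t A) N.
Proof.
move=> pc cA cB cC N ltcN; have [d dr cd] := prime_has_rep pc.
set q := (1 - t ^+ size c)^-1.
have q_gt1 : 1 < q := factor_gt1 (prime_neq0 pc).
(* The representative [d] of the class of [c] gains the factor [q]. *)
pose extra (c' : seq (darc X)) := if c' == d then q else 1.
have extraE : \prod_(k < N) \prod_(c' in prime_reps X k) extra c' = q.
  rewrite (bigD1 (Ordinal ltcN)) //= (bigD1 d) //= {1}/extra eqxx.
  rewrite big1 => [|c' /andP[_ c'd]]; last by rewrite /extra [_ == _](negbTE c'd).
  rewrite big1 ?mulr1 // => k kc; rewrite big1 // => c' _; rewrite /extra.
  case: eqP => // /(congr1 size); rewrite !size_tuple => kE.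
  by case/eqP: kc; apply: val_inj.
have gd D : gmon (weight t D) d = if all (mem D) c then t ^+ size c else 0.
  by rewrite gmon_weight size_tuple (eq_all_r cd).
rewrite -{1}extraE -!big_split; apply: ler_prod => k _.
have facs_ge0 (c' : k.-tuple (darc X)) : c' \in prime_reps X k ->
    0 <= (1 - gmon (weight t B) c')^-1 * (1 - gmon (weight t C) c')^-1.
  move=> /prime_repsP/prime_neq0 c'0.
  by rewrite mulr_ge0 // (le_trans ler01) // factor_ge1.
have extra_ge0 c' : 0 <= extra c'.
  by rewrite /extra; case: eqP; rewrite ?ler01 // (le_trans ler01) ?ltW.
rewrite -!big_split /=; apply/andP; split.
  by apply: prodr_ge0 => c' /facs_ge0; apply: mulr_ge0.
apply: ler_prod => c' c'r; rewrite mulr_ge0 ?facs_ge0 //=.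
rewrite /extra; case: eqP => [->|_]; last first.
  by rewrite mul1r; apply/factor_ge/(prime_repsP c'r).
rewrite !gd; have -> : all (mem A) c by apply/allP.
have /negbTE-> : ~~ all (mem B) c by apply/allP.
have /negbTE-> : ~~ all (mem C) c by apply/allP.
by rewrite subr0 invr1 !mulr1.
Qed.

(** If all prime cycles in [A] lie in [B] or in [C], the product factors; a further
    one leaves a gap between the partial products for [A] and the product of
    the (stationary) values for [B] and [C]. *)
Lemma edge_zeta_split :
  {in B &, injective (@orig X)} -> {in C &, injective (@orig X)} ->
  splits A B C <->
  edge_zeta (weight t A) = edge_zeta (weight t B) * edge_zeta (weight t C).
Proof.
move=> injB injC; pose N0 := maxn #|B|.+1 #|C|.+1.
have PB N : (N0 <= N)%N -> partial_zeta (weight t B) N = edge_zeta (weight t B).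
  by rewrite geq_max => /andP[+ _]; apply: partial_zeta_stationary.
have PC N : (N0 <= N)%N -> partial_zeta (weight t C) N = edge_zeta (weight t C).
  by rewrite geq_max => /andP[_]; apply: partial_zeta_stationary.
have v_gt0 : 0 < edge_zeta (weight t B) * edge_zeta (weight t C).
  rewrite -(PB N0) // -(PC N0) // mulr_gt0 // (lt_le_trans ltr01) //;
  exact: partial_zeta_ge1.
split=> [spl|].
  apply: (edge_zeta_lim (N0 := N0)) => N leN.
  by rewrite partial_zeta_split // PB // PC.
apply: contraPP => /existsNP[c /not_implyP[pc /not_implyP[cA]]].
move=> /not_orP[cB cC].
have q_gt1 := factor_gt1 (prime_neq0 pc).
apply: (edge_zeta_neq (w := (1 - t ^+ size c)^-1 *
    (edge_zeta (weight t B) * edge_zeta (weight t C)))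
    (N0 := maxn N0 (size c).+1)) => //.
  by rewrite ltr_pMl.
move=> N; rewrite geq_max => /andP[leN ltcN].
by rewrite -(PB N) // -(PC N) // partial_zeta_nonsplit.
Qed.

End Split.
End Zeta.

(** * Configurations preserved by a matching of zeta functions *)

Section Transfer.
Local Open Scope ring_scope.
Variable R : realType.

(** Kept apart from [zeta_equiv] so that a bijection and its inverse can be used
    together. *)
Definition zeta_match (X X' : mgraph) (phi : darc X -> darc X') : Prop :=
  [/\ bijective phi,
      forall a, phi (ainv a) = ainv (phi a) &
      exists2 eps : R, 0 < eps &
        forall u : darc X' -> Cplx R, (forall a, `|u a| < (eps%:C)%C) ->
          edge_zeta (u \o phi) = edge_zeta u].

Lemma zeta_match_sym (X X' : mgraph) (phi : darc X -> darc X') psi :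
  cancel phi psi -> cancel psi phi -> zeta_match phi -> zeta_match psi.
Proof.
move=> phiK psiK [_ phi_inv [eps eps_gt0 zetaE]]; split.
- by exists phi.
- by move=> a; rewrite -{1}(psiK a) -phi_inv phiK.
exists eps => // u u_lt; rewrite -zetaE; last by move=> a; apply: u_lt.
by congr edge_zeta; apply/funext => a /=; rewrite phiK.
Qed.

(** Both sides of [edge_zeta_split] are compared at the weight [t] on an arc set
    and on its image, for one [t] small enough for the two graphs. *)
Lemma splits_transfer (X X' : mgraph) (phi : darc X -> darc X')
    (A B C : {set darc X}) :
  zeta_match phi -> B \subset A -> C \subset A -> [disjoint B & C] ->
  {in B &, injective (@orig X)} -> {in C &, injective (@orig X)} ->
  {in phi @: B &, injective (@orig X')} ->
  {in phi @: C &, injective (@orig X')} ->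
  splits A B C <-> splits (phi @: A) (phi @: B) (phi @: C).
Proof.
move=> [bij_phi _ [eps eps_gt0 zetaE]] BA CA BC injB injC injB' injC'.
have inj_phi := bij_inj bij_phi.
pose t : Cplx R := ((Num.min eps 1 / 2)%:C)%C.
have m_gt0 : 0 < Num.min eps 1 by rewrite lt_min eps_gt0 ltr01.
have m_half : Num.min eps 1 / 2 < Num.min eps 1.
  by rewrite ltr_pdivrMr // ltr_pMr // ltr1n.
have t_gt0 : 0 < t by rewrite ltcR divr_gt0.
have t_lt1 : t < 1 by rewrite ltcR (lt_le_trans m_half) // ge_min lexx orbT.
have t_lte : t < (eps%:C)%C by rewrite ltcR (lt_le_trans m_half) // ge_min lexx.
have zeta_weightE (D : {set darc X}) :
    edge_zeta (weight t (phi @: D)) = edge_zeta (weight t D).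
  rewrite -zetaE => [|a].
    congr edge_zeta; apply/funext => a.
    by rewrite /= /weight (mem_imset _ _ inj_phi).
  rewrite /weight; case: ifP => _; first by rewrite gtr0_norm.
  by rewrite normr0 ltcR.
have BC' : [disjoint phi @: B & phi @: C].
  rewrite -setI_eq0 -imsetI; last by move=> *; apply: inj_phi.
  by rewrite imset_eq0 setI_eq0.
rewrite (edge_zeta_split t_gt0 t_lt1 BA CA BC) //.
rewrite (edge_zeta_split t_gt0 t_lt1 (imsetS _ BA) (imsetS _ CA) BC') //.
by rewrite !zeta_weightE.
Qed.

Definition is_loop (X : mgraph) (a : darc X) := term a == orig a.

(** Three loops at a vertex qualify; the lemmas exclude loops by hypotheses. *)
Definition triangle (X : mgraph) (a b c : darc X) : bool :=
  [&& term a == orig b, term b == orig c & term c == orig a].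

(** The case of empty parts in [splits_transfer]: the value 1 at the weight of an
    arc set means that no prime cycle lies in it. *)
Lemma has_prime_transfer (X X' : mgraph) (phi : darc X -> darc X') c :
  zeta_match phi -> is_prime_cycle c ->
  exists2 c', is_prime_cycle c' & {subset c' <= [seq phi a | a <- c]}.
Proof.
move=> match_phi pc; apply: contrapT => /forall2NP noc.
have nil_inj (Y : mgraph) : {in finset.set0 &, injective (@orig Y)}.
  by move=> a b; rewrite inE.
have := @splits_transfer _ _ phi [set a in c] finset.set0 finset.set0 match_phi.
rewrite !imset0 => /(_ (sub0set _) (sub0set _)).
rewrite -setI_eq0 setI0 eqxx => /(_ isT (nil_inj _) (nil_inj _) (nil_inj _) (nil_inj _)).
case=> _ /(_ _)/wrap[].
  move=> c' pc' c'sub; case: (noc c') => // -[] a /c'sub /imsetP[b].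
  by rewrite inE => bc ->; apply: map_f.
move=> /(_ c pc) []; first by move=> a; rewrite inE.
  by case: c pc {noc} => [/prime_neq0|a c _ /(_ a (mem_head _ _))]; rewrite ?inE.
by case: c pc {noc} => [/prime_neq0|a c _ /(_ a (mem_head _ _))]; rewrite ?inE.
Qed.

Definition digon (X : mgraph) (a b : darc X) : bool :=
  (term a == orig b) && (term b == orig a).

Lemma is_loop_ainv (X : mgraph) (a : darc X) : is_loop (ainv a) = is_loop a.
Proof. by rewrite /is_loop orig_ainv term_ainv eq_sym. Qed.

Lemma same_edge (X : mgraph) (a b : darc X) :
  (a.1 == b.1) = (a == b) || (a == ainv b).
Proof.
case: a b => [e s] [f s']; rewrite /ainv !xpair_eqE /=.
by case: (e == f) => //; case: s s' => [] [].
Qed.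

Lemma succ_edge_neq (X : mgraph) (a b : darc X) :
  term a = orig b -> ~~ is_loop a -> term b != orig a -> a.1 != b.1.
Proof.
move=> tab la tba; rewrite same_edge negb_or; apply/andP; split.
  by apply: contraNneq la => ab; rewrite /is_loop tab ab.
by apply: contraNneq tba => ->; rewrite orig_ainv.
Qed.

Lemma triangle_edges (X : mgraph) (a b c : darc X) :
  triangle a b c -> ~~ is_loop a -> ~~ is_loop b -> ~~ is_loop c ->
  uniq [:: a.1; b.1; c.1].
Proof.
rewrite /is_loop /triangle => /and3P[/eqP ab /eqP bc /eqP ca] la lb lc.
rewrite /= !inE negb_or [a.1 == c.1]eq_sym -!andbA andbT.
apply/and3P; split.
- by apply: succ_edge_neq; rewrite // bc -ca eq_sym.
- by apply: succ_edge_neq; rewrite // ab -bc eq_sym.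
- by apply: succ_edge_neq; rewrite // ca -ab eq_sym.
Qed.

Lemma triangle_no_digon (X : mgraph) (a b c : darc X) :
  triangle a b c -> ~~ is_loop c -> ~~ digon a b.
Proof.
by rewrite /is_loop /triangle /digon => /and3P[-> /eqP -> /eqP ->]; rewrite eq_sym.
Qed.

Lemma triangle_rot (X : mgraph) (a1 a2 a3 : darc X) : triangle a1 a2 a3 -> triangle a2 a3 a1.
Proof. by rewrite /triangle => /and3P[-> -> ->]. Qed.

Lemma triangle_rev (X : mgraph) (a1 a2 a3 : darc X) :
  triangle a1 a2 a3 -> triangle (ainv a3) (ainv a2) (ainv a1).
Proof.
by rewrite /triangle !orig_ainv !term_ainv => /and3P[/eqP-> /eqP-> /eqP->];
   rewrite !eqxx.
Qed.

Lemma triangle_orig_inj (X : mgraph) (a b c : darc X) :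
  triangle a b c -> ~~ is_loop a -> ~~ is_loop b -> ~~ is_loop c ->
  {in [set a; b; c] &, injective (@orig X)}.
Proof.
rewrite /is_loop /triangle => /and3P[/eqP-> /eqP-> /eqP->] la lb lc.
move=> x y; rewrite !inE -!orbA => /or3P[] /eqP -> /or3P[] /eqP -> // /eqP.
- by rewrite eq_sym (negbTE la).
- by rewrite (negbTE lc).
- by rewrite (negbTE la).
- by rewrite eq_sym (negbTE lb).
- by rewrite eq_sym (negbTE lc).
- by rewrite (negbTE lb).
Qed.

Section OneWay.
Variables (X X' : mgraph) (phi : darc X -> darc X').
Hypothesis match_phi : zeta_match phi.

Lemma match_ainv a : phi (ainv a) = ainv (phi a).
Proof. by case: match_phi. Qed.

Lemma match_loop_imp a : is_loop a -> is_loop (phi a).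
Proof.
move=> la; have pa : is_prime_cycle [:: a].
  by apply: uniq_edges_prime; rewrite // /is_cycle /= andbT.
have [c' pc' c'sub] := has_prime_transfer match_phi pa.
case: c' pc' c'sub => [/prime_neq0 //|x c' pc' sub].
have xE : x = phi a by apply/eqP; have := sub x (mem_head _ _); rewrite inE.
have [cc _ _ _] := pc'; have [y /sub] := cycle_succ cc (mem_head _ _).
by rewrite inE xE => /eqP -> /eqP.
Qed.
End OneWay.

Section Bijection.
Variables (X X' : mgraph) (phi : darc X -> darc X') (psi : darc X' -> darc X).
Hypotheses (phiK : cancel phi psi) (psiK : cancel psi phi).
Hypothesis match_phi : zeta_match phi.

Lemma match_loop a : is_loop (phi a) = is_loop a.
Proof.
have match_psi := zeta_match_sym phiK psiK match_phi.
by apply/idP/idP => [/(match_loop_imp match_psi)|/(match_loop_imp match_phi) //]; rewrite phiK.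
Qed.

Lemma match_digon_imp a b : ~~ is_loop a -> ~~ is_loop b -> a != ainv b ->
  digon a b -> digon (phi a) (phi b).
Proof.
move=> la lb ab /andP[tab tba].
have pc : is_prime_cycle [:: a; b].
  apply: uniq_edges_prime; first by rewrite /is_cycle /= tab tba.
  rewrite /= inE same_edge negb_or ab !andbT.
  by apply: contraNneq la => ab'; rewrite /is_loop {1}ab'.
have [c' pc' c'sub] := has_prime_transfer match_phi pc.
case: c' pc' c'sub => [/prime_neq0 //|x c' pc' sub].
have [cc _ _ _] := pc'.
have [y yc /eqP xy] := cycle_succ cc (mem_head x c').
have [z zc /eqP yz] := cycle_succ cc yc.
move: la lb; rewrite -!match_loop /is_loop => /negbTE la /negbTE lb.
move: (sub _ (mem_head x c')) (sub _ yc) (sub _ zc) xy yz.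
rewrite !inE /digon.
by do 3![case/orP=> /eqP ->]; rewrite ?la ?lb // => -> ->.
Qed.
End Bijection.

Section Matching.
Variables (X X' : mgraph) (phi : darc X -> darc X') (psi : darc X' -> darc X).
Hypotheses (phiK : cancel phi psi) (psiK : cancel psi phi).
Hypothesis match_phi : zeta_match phi.

Let match_psi := zeta_match_sym phiK psiK match_phi.

Lemma match_digon a b : ~~ is_loop a -> ~~ is_loop b -> a != ainv b ->
  digon (phi a) (phi b) = digon a b.
Proof.
move=> la lb ab; apply/idP/idP; last exact: (match_digon_imp phiK psiK).
move/(match_digon_imp psiK phiK match_psi); rewrite !phiK; apply.
- by rewrite (match_loop phiK psiK).
- by rewrite (match_loop phiK psiK).
- by rewrite -match_ainv // (can_eq phiK).
Qed.

(** The prime cycle in the image has no loop and no 2-cycle to run through, so it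
    passes through the three arcs in one of the two cyclic orders. Both orders
    can occur, since the monomial of a cycle forgets the order of its arcs. *)
Lemma match_triangle a b c :
  triangle a b c -> ~~ is_loop a -> ~~ is_loop b -> ~~ is_loop c ->
  triangle (phi a) (phi b) (phi c) || triangle (phi a) (phi c) (phi b).
Proof.
move=> tabc la lb lc; have uabc := triangle_edges tabc la lb lc.
have pc : is_prime_cycle [:: a; b; c].
  by apply: uniq_edges_prime; rewrite // /is_cycle /= andbT andbA -andbA.
have [c' pc' c'sub] := has_prime_transfer match_phi pc.
case: c' pc' c'sub => [/prime_neq0 //|x c' pc' sub].
have [cc _ _ _] := pc'.
have [y yc /eqP xy] := cycle_succ cc (mem_head x c').
have [z zc /eqP yz] := cycle_succ cc yc.
(* Four successive arcs, each among three, with no loop or 2-cycle: the last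
   one is the first one again. *)
have [w wc /eqP zw] := cycle_succ cc zc.
have [tbca tcab] : triangle b c a /\ triangle c a b.
  by move: tabc; rewrite /triangle => /and3P[-> -> ->].
move: uabc; rewrite /= !inE !same_edge !negb_or !andbT.
case/andP=> /andP[/andP[_ ab] /andP[_ ac]] /andP[_ bc].
have ca : c != ainv a by rewrite eq_sym (inv_eq (@ainvK X)).
have := triangle_no_digon tabc lc; rewrite -match_digon // => nab.
have := triangle_no_digon tbca la; rewrite -match_digon // => nbc.
have := triangle_no_digon tcab lb; rewrite -match_digon // => nca.
move: la lb lc; rewrite -!(match_loop phiK psiK match_phi) /is_loop.
move=> /negbTE la /negbTE lb /negbTE lc.
move: (sub _ (mem_head x c')) (sub _ yc) (sub _ zc) (sub _ wc) xy yz zw.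
move: nab nbc nca; rewrite !inE /digon /triangle => nab nbc nca.
do 4![case/or3P=> /eqP ->]; rewrite ?la ?lb ?lc // => xy yz zw;
  move: nab nbc nca; rewrite ?xy ?yz ?zw ?orbT //=.
Qed.

(** Minimal cycles do not tell where a loop is attached: the loop [e] and the
    triangle are prime cycles wherever [e] sits. What tells is the cycle
    [e a b c], which lies neither in [e] nor in the triangle: it is there when
    [e] is attached, whereas a loop off the triangle leaves every prime cycle
    in one of the two parts. *)
Lemma match_loop_at e a b c : is_loop e ->
  triangle a b c -> ~~ is_loop a -> ~~ is_loop b -> ~~ is_loop c ->
  orig e = orig a ->
  orig (phi e) \in [:: orig (phi a); orig (phi b); orig (phi c)].
Proof.
move=> le tabc la lb lc ea; apply: contrapT => /negP off.
pose T := [set a; b; c]; have eT : e \notin T.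
  by rewrite !inE !negb_or -andbA; apply/and3P; split; apply: contraTneq le => ->.
have injT : {in T &, injective (@orig X)} := triangle_orig_inj tabc la lb lc.
have TE : phi @: T = [set phi a; phi b; phi c].
  by rewrite !imsetU !imset_set1.
have [la' lb' lc'] :
    [/\ ~~ is_loop (phi a), ~~ is_loop (phi b) & ~~ is_loop (phi c)].
  by rewrite !(match_loop phiK psiK match_phi).
have injT' : {in phi @: T &, injective (@orig X')}.
  rewrite TE; case/orP: (match_triangle tabc la lb lc) => t'.
    exact: triangle_orig_inj.
  by rewrite setUAC; apply: triangle_orig_inj.
have inj1 (Y : mgraph) (a' : darc Y) : {in [set a'] &, injective (@orig Y)}.
  by move=> x y /set1P-> /set1P->.
have := @splits_transfer _ _ phi (e |: T) [set e] T match_phi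
  (subsetUl _ _) (subsetUr _ _).
rewrite disjoints1 imset_set1 => /(_ eT (inj1 _ e) injT (inj1 _ _) injT') [_].
have le' : is_loop (phi e) by rewrite (match_loop phiK psiK match_phi).
have offE x : x \in phi @: T -> (orig x == orig (phi e)) = false.
  rewrite TE !inE -orbA => xT; apply: contraNF off => /eqP <-.
  by rewrite !inE; case/or3P: xT => /eqP ->; rewrite eqxx ?orbT.
(* The loop [phi e] can only be followed by itself. *)
move=> /(_ _)/wrap[].
  move=> c' pc' c'A; have [cc' _ _ _] := pc'.
  have c'T x : x \in c' -> x = phi e \/ x \in phi @: T.
    move/c'A; rewrite imsetU imset_set1 => /setU1P[]; by [left | right].
  case: (boolP (phi e \in c')) => ec'; [left | right].
    suff /allP h : all (pred1 (phi e)) c' by move=> x /h /= /eqP->; rewrite inE.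
    have [_ cyc] := andP cc'.
    apply: (cycle_invariant cyc ec'); first exact: eqxx.
    move=> x y _ yc' /= /eqP-> ey; case: (c'T y yc') => [-> //|/offE].
    by move: le'; rewrite /is_loop => /eqP <-; rewrite eq_sym ey.
  move=> x xc'; case: (c'T x xc') => // xE; by rewrite -xE xc' in ec'.
move=> /(_ [:: e; a; b; c])[].
- have [/and3P[tab tbc tca] /eqP le_] := (tabc, le).
  apply: uniq_edges_prime.
    rewrite /is_cycle /= tab tbc /= le_ ea eqxx /= andbT.
    by move/eqP: tca => ->; rewrite -ea.
  rewrite map_cons cons_uniq (triangle_edges tabc) // andbT !inE !same_edge.
  by rewrite !negb_or; apply/and3P; split; apply/andP; split;
     apply: contraTneq le => ->; rewrite ?is_loop_ainv.
- by move=> x; rewrite !inE -!orbA.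
- move=> /(_ a); rewrite !inE eqxx orbT => /(_ isT) /eqP ae.
  by rewrite ae le in la.
- move=> /(_ e (mem_head _ _)) eT'; by rewrite eT' in eT.
Qed.

End Matching.
End Transfer.

(** * Coherent orientation of triangles *)

Section Orientation.
Variables (I : finType) (Y : mgraph) (b : I -> I -> darc Y).

Hypothesis b_inv : forall x y, x != y -> b y x = ainv (b x y).
Hypothesis b_loop : forall x y, x != y -> ~~ is_loop (b x y).

Definition distinct3 (x y z : I) := [&& x != y, y != z & z != x].

Definition directed x y z := triangle (b x y) (b y z) (b z x).
Definition reversed x y z := triangle (b x y) (b z x) (b y z).

Hypothesis b_triangle : forall x y z, distinct3 x y z ->
  directed x y z || reversed x y z.

(** Holds of all orderings of a set of three vertices or of none. *)
Let dir3 x y z := distinct3 x y z && directed x y z.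

Let dir3_rot x y z : dir3 x y z -> dir3 y z x.
Proof.
by move=> /andP[/and3P[xy yz zx] /triangle_rot t]; apply/andP; split=> //; apply/and3P.
Qed.

Let dir3_flip x y z : dir3 x y z -> dir3 x z y.
Proof.
move=> /andP[/and3P[xy yz zx] /triangle_rev t]; apply/andP; split.
  by apply/and3P; split; rewrite eq_sym.
by move: t; rewrite -!b_inv // => /triangle_rot/triangle_rot.
Qed.

(** Two triangles on a common arc [b x y] run in the same sense. Otherwise
    [b y z] would be attached to the end of [b x y] and [b y w] to its origin;
    the triangle on [y], [z], [w] makes these two arcs meet elsewhere too, which
    in either order turns [b w x] or [b z x] into a loop. *)
Let dir3_swap x y z w : dir3 x y z -> w != x -> w != y -> dir3 x y w.
Proof.
move=> /andP[d3 dxyz] wx wy; have /and3P[xy yz zx] := d3.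
have [-> | wz] := eqVneq w z; first exact/andP.
have yw : y != w by rewrite eq_sym.
have xyw : distinct3 x y w by apply/and3P.
rewrite /dir3 xyw /=; case/orP: (b_triangle xyw) => // rxyw.
have yzw : distinct3 y z w by rewrite /distinct3 yz eq_sym wz wy.
have /and3P[/eqP d1 /eqP d2 /eqP d3'] := dxyz.
have /and3P[/eqP r1 /eqP r2 /eqP r3] := rxyw.
case/orP: (b_triangle yzw) => /and3P[/eqP e1 /eqP e2 /eqP e3].
  have := b_loop wx; rewrite /is_loop => /eqP[].
  by rewrite -r1 d1 -e3 (b_inv yw) term_ainv.
have := b_loop zx; rewrite /is_loop => /eqP[].
by rewrite -d2 e1 (b_inv yw) orig_ainv r3.
Qed.

(** [dir3_swap] replaces one vertex of a directed triangle at a time, so that the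
    sense of one triangle determines that of all. *)
Lemma coherent_triangles :
  (forall x y z, distinct3 x y z -> directed x y z) \/
  (forall x y z, distinct3 x y z -> reversed x y z).
Proof.
case: (pselect (exists x y z, dir3 x y z)) => [[x [y [z dxyz]]]|ndir]; last first.
  right=> x y z d3; case/orP: (b_triangle d3) => // dxyz.
  by case: ndir; exists x, y, z; apply/andP.
left=> p q s /and3P[pq qs sp].
have [y' [z' dp]] : exists y' z', dir3 p y' z'.
  have [-> | py] := eqVneq p y; first by exists z, x; apply: dir3_rot.
  have [-> | pz] := eqVneq p z; first by exists x, y; do 2!apply: dir3_rot.
  by exists y, z; apply/dir3_rot/dir3_rot/(dir3_swap (dir3_rot dxyz)).
have qp : q != p by rewrite eq_sym.
have [t dpq] : exists t, dir3 p q t.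
  have [-> | qz] := eqVneq q z'; first by exists y'; apply: dir3_flip.
  by exists z'; apply/dir3_flip/(dir3_swap (dir3_flip dp)).
have sq : s != q by rewrite eq_sym.
by have /andP[] := dir3_swap dpq sp sq.
Qed.
End Orientation.

Lemma directed_origin (I : finType) (Y : mgraph) (b : I -> I -> darc Y) :
  (forall x y, x != y -> b y x = ainv (b x y)) ->
  (forall x y z, distinct3 x y z -> directed b x y z) ->
  exists w : I -> vert Y, forall x y, x != y -> orig (b x y) = w x.
Proof.
move=> b_inv dir.
exists (fun x => orig (b x (odflt x [pick y | y != x]))) => x y xy.
case: pickP => [y' y'x /=|/(_ y)]; last by rewrite eq_sym xy.
have [-> // | yy'] := eqVneq y y'.
have d3 : distinct3 x y y' by apply/and3P.
have /and3P[_ _ /eqP <-] := dir _ _ _ d3.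
by rewrite -orig_ainv -b_inv.
Qed.

(** The reversed case is the directed case for the family of inverse arcs. *)
Lemma common_vertices (I : finType) (Y : mgraph) (b : I -> I -> darc Y) :
  (forall x y, x != y -> b y x = ainv (b x y)) ->
  (forall x y, x != y -> ~~ is_loop (b x y)) ->
  (forall x y z, distinct3 x y z -> directed b x y z || reversed b x y z) ->
  exists w : I -> vert Y, injective w /\
    forall x y, x != y -> ends (b x y).1 = [set w x; w y].
Proof.
move=> b_inv b_loop b_tri.
have winj (w : I -> vert Y) :
    (forall x y, x != y -> ends (b x y).1 = [set w x; w y]) -> injective w.
  move=> wE x y; apply: contra_eq => xy.
  have := wE _ _ xy; rewrite ends_darc => eE.
  have : #|[set orig (b x y); term (b x y)]| = 2.
    by have := b_loop _ _ xy; rewrite cards2 /is_loop eq_sym => ->.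
  by rewrite eE cards2; case: (w x != w y).
suff [w wE] : exists w : I -> vert Y,
    forall x y, x != y -> ends (b x y).1 = [set w x; w y].
  by exists w; split=> //; apply: winj.
case: (coherent_triangles b_inv b_loop b_tri) => [dir|rev].
  have [w wE] := directed_origin b_inv dir; exists w => x y xy.
  by rewrite ends_darc -orig_ainv -b_inv // !wE // eq_sym.
have [||w wE] := @directed_origin I Y (fun x y => b y x).
- by move=> x y xy; rewrite -b_inv // eq_sym.
- move=> x y z d3; have /triangle_rev := rev _ _ _ d3.
  have /and3P[xy yz zx] := d3; rewrite -!b_inv // /directed.
  by move=> /triangle_rot/triangle_rot.
exists w => x y xy.
by rewrite ends_darc -orig_ainv -b_inv // setUC !wE // eq_sym.
Qed.

(** * Subgraphs isomorphic to a complete graph *)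

(** The subgraph with vertex set [S] and edge set [E] is a complete graph on [r]
    vertices (see [giso_subgraphP]); both kinds of subgraph counts are instances. *)
Definition complete_on (X : mgraph) r (S : {set vert X}) (E : {set edge X}) : Prop :=
  [/\ #|S| = r, {in E, forall e, src e != tgt e}, {in E &, injective (@ends X)} &
      {in S &, forall x y, x != y -> exists2 e, e \in E & ends e = [set x; y]}].

Lemma complete_simple r : simple_graph (complete r).
Proof.
split=> [[[i j] /= lt_ij]|[[i j] /= lt_ij] [[i' j'] /= lt_ij']].
  by apply: contraTneq lt_ij => ->; rewrite ltnn.
rewrite /ends /= => E; apply: val_inj => /=.
have: i \in [set i'; j'] by rewrite -E set21.
have: j \in [set i'; j'] by rewrite -E set22.
rewrite !inE => /orP[] /eqP ej /orP[] /eqP ei; subst => //.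
- by rewrite ltnn in lt_ij.
- by have := ltn_trans lt_ij lt_ij'; rewrite ltnn.
- by rewrite ltnn in lt_ij.
Qed.

Lemma complete_adjacent r (i j : 'I_r) : i != j ->
  exists p : edge (complete r), ends p = [set i; j].
Proof.
move=> ij; case: (ltngtP i j) => [lt_ij|lt_ji|/val_inj eij].
- by exists (exist _ (i, j) lt_ij).
- by exists (exist _ (j, i) lt_ji); rewrite /ends /= setUC.
- by rewrite eij eqxx in ij.
Qed.

Lemma loopless_ends (X : mgraph) (e : edge X) : (src e != tgt e) = (#|ends e| == 2).
Proof. by rewrite cards2; case: (_ != _). Qed.

Lemma giso_completeP (X : mgraph) r :
  giso X (complete r) <->
  [/\ #|vert X| = r, simple_graph X &
      forall x y : vert X, x != y -> exists e, ends e = [set x; y]].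
Proof.
have [K_loopless K_inj] := complete_simple r.
split=> [[f [h [bij_f bij_h fhE]]]|[Xr [X_loopless X_inj] X_adj]].
  have inj_f := bij_inj bij_f; split.
  - by rewrite (bij_eq_card bij_f) card_ord.
  - split=> [e|e e' ee'].
      by rewrite loopless_ends -(card_imset _ inj_f) -fhE -loopless_ends K_loopless.
    by apply: (bij_inj bij_h); apply: K_inj; rewrite !fhE ee'.
  - move=> x y xy; have [|p pE] := @complete_adjacent r (f x) (f y).
      by rewrite (inj_eq inj_f).
    have [h' _ h'K] := bij_h; exists (h' p).
    by apply: (imset_inj inj_f); rewrite -fhE h'K pE imsetU !imset_set1.
(* Any numbering of the vertices is an isomorphism. *)
pose f (x : vert X) : 'I_r := cast_ord Xr (enum_rank x).
have bij_f : bijective f.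
  apply: (Bijective (g := fun i => enum_val (cast_ord (esym Xr) i))) => x.
    by rewrite /f cast_ordK enum_rankK.
  by rewrite /f enum_valK cast_ordKV.
have inj_f := bij_inj bij_f.
have [g fK gK] := bij_f.
have /choice[h hE] (e : edge X) : exists p : edge (complete r), ends p = f @: ends e.
  have [|p pE] := @complete_adjacent r (f (src e)) (f (tgt e)).
    by rewrite (inj_eq inj_f) X_loopless.
  by exists p; rewrite pE imsetU !imset_set1.
have /choice[h' h'E] (p : edge (complete r)) : exists e, f @: ends e = ends p.
  have [|e eE] := X_adj (g (src p)) (g (tgt p)).
    by rewrite (can_eq gK) K_loopless.
  by exists e; rewrite eE imsetU !imset_set1 !gK.
exists f, h; split=> //; exists h' => [e|p].
  by apply: X_inj; apply: (imset_inj inj_f); rewrite h'E hE.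
by apply: K_inj; rewrite hE h'E.
Qed.

Lemma giso_subgraphP (X : mgraph) r (S : {set vert X}) (E : {set edge X})
    (sub_ES : forall e, e \in E -> ends e \subset S) :
  giso (subgraph sub_ES) (complete r) <-> complete_on r S E.
Proof.
rewrite giso_completeP /= card_sig.
have endsE (e : edge (subgraph sub_ES)) : val @: ends e = ends (val e).
  by rewrite imsetU !imset_set1.
split=> [[Sr [noloop inj_ends] adj]|[Sr noloop inj_ends adj]].
  split=> //.
  - by move=> e eE; have := noloop (exist _ e eE).
  - move=> e e' eE e'E ee'.
    have /inj_ends[//] : ends (exist _ e eE : edge (subgraph sub_ES)) =
                       ends (exist _ e' e'E : edge (subgraph sub_ES)).
      by apply: (imset_inj val_inj); rewrite !endsE.
  - move=> x y xS yS xy.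
    have [|e eE] := adj (exist _ x xS) (exist _ y yS); first exact: xy.
    by exists (val e); [exact: valP | rewrite -endsE eE imsetU !imset_set1].
split=> //.
- split=> [e|e e' ee']; first exact: (noloop _ (valP e)).
  by apply: val_inj; apply: inj_ends; rewrite ?(valP e) ?(valP e') // -!endsE ee'.
- move=> x y xy; have [|e eE exy] := adj _ _ (valP x) (valP y); first exact: xy.
  exists (exist _ e eE); apply: (imset_inj val_inj).
  by rewrite endsE exy imsetU !imset_set1.
Qed.

Section EdgeSets.
Variable X : mgraph.
Implicit Types (S : {set vert X}) (E : {set edge X}) (e : edge X).

(** The vertex set of the edge-induced subgraph. *)
Definition covered E : {set vert X} := \bigcup_(e in E) ends e.

(** The edge set of the vertex-induced subgraph. *)
Definition inside S : {set edge X} := [set e | ends e \subset S].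

Lemma arc_between e x y : ends e = [set x; y] ->
  exists a : darc X, [/\ a.1 = e, orig a = x & term a = y].
Proof.
move=> exy; have : x \in ends e by rewrite exy set21.
have : y \in ends e by rewrite exy set22.
rewrite {1 2}/ends !inE => /orP[]/eqP ey /orP[]/eqP ex.
- exists (e, true); split=> //=.
  have : tgt e \in [set x; y] by rewrite -exy set22.
  by rewrite !inE ex ey orbb => /eqP.
- by exists (e, false); split=> //=; rewrite ?ex ?ey.
- by exists (e, true); split=> //=; rewrite ?ex ?ey.
- exists (e, false); split=> //=.
  have : src e \in [set x; y] by rewrite -exy set21.
  by rewrite !inE ex ey orbb => /eqP.
Qed.

Lemma complete_arc r S E x y : complete_on r S E ->
  x \in S -> y \in S -> x != y ->
  exists a : darc X, [/\ a.1 \in E, orig a = x & term a = y].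
Proof.
move=> [_ _ _ adj] xS yS xy; have [e eE /arc_between[a [ae ax ay]]] := adj x y xS yS xy.
by exists a; rewrite ae.
Qed.

(** From two vertices on, no vertex of a complete graph is isolated. *)
Lemma covered_inside r S : (2 <= r)%N ->
  complete_on r S (inside S) -> covered (inside S) = S.
Proof.
move=> r2 [Sr _ _ adj]; apply/setP => x; apply/bigcupP/idP => [[e]|xS].
  by rewrite inE => /fintype.subsetP eS /eS.
have : (0 < #|S :\ x|)%N by move: r2; rewrite -Sr (cardsD1 x) xS.
case/card_gt0P => y; rewrite !inE eq_sym => /andP[xy yS].
by have [e eS exy] := adj x y xS yS xy; exists e; rewrite // exy set21.
Qed.

Lemma simple_inside r E : simple_graph X ->
  complete_on r (covered E) E -> inside (covered E) = E.
Proof.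
move=> [noloop inj_ends] [_ _ _ adj]; apply/setP => e; rewrite inE.
apply/idP/idP => [/fintype.subsetP esub|]; last exact: finset.bigcup_sup.
have [||f fE fe] := adj (src e) (tgt e) _ _ (noloop e).
- by apply: esub; rewrite set21.
- by apply: esub; rewrite set22.
- by rewrite -(inj_ends _ _ fe).
Qed.

Lemma s_vE r : s_v (complete r) X =
  #|[set S : {set vert X} | `[< complete_on r S (inside S) >]]|.
Proof.
apply: eq_card => S; rewrite !inE; apply/asboolP/asboolP; by rewrite giso_subgraphP.
Qed.

Lemma s_eE r : s_e (complete r) X =
  #|[set E : {set edge X} | `[< complete_on r (covered E) E >]]|.
Proof.
apply: eq_card => E; rewrite !inE; apply/asboolP/asboolP; by rewrite giso_subgraphP.
Qed.

Lemma simple_s_e_s_v r : (2 <= r)%N -> simple_graph X ->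
  s_e (complete r) X = s_v (complete r) X.
Proof.
move=> r2 sX; rewrite s_eE s_vE.
rewrite -(card_in_imset (f := covered)) => [|E F]; last first.
  by rewrite !inE => /asboolP/(simple_inside sX) {2}<- /asboolP/(simple_inside sX) {2}<- ->.
apply: eq_card => S; rewrite [RHS]inE; apply/imsetP/asboolP => [[E]|KS].
  by rewrite inE => /asboolP KE ->; rewrite (simple_inside sX KE).
by exists (inside S); rewrite ?inE (covered_inside r2 KS) //; apply/asboolP.
Qed.

(** The sizes on which the zeta function gives no information; without loops, a
    set of at most one vertex has no edge inside. *)
Lemma small_clique r : loopless X -> (r <= 1)%N -> (r <= #|vert X|)%N ->
  (0 < s_v (complete r) X)%N.
Proof.
move=> noloop r1 rX; rewrite s_vE; apply/card_gt0P.
have [S Sr] : exists S : {set vert X}, #|S| = r.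
  case: r r1 rX => [|[|r]] // _; first by exists finset.set0; rewrite cards0.
  by case/card_gt0P => x _; exists [set x]; rewrite cards1.
exists S; rewrite inE; apply/asboolP.
have noe e : e \notin inside S.
  rewrite inE; apply/negP => /subset_leq_card; rewrite Sr.
  have := noloop e; rewrite loopless_ends => /eqP -> /leq_trans/(_ r1).
  by rewrite ltnn.
split=> //.
- by move=> e f; rewrite (negbTE (noe e)).
- move=> x y xS yS xy; have: ([set x; y] \subset S) by rewrite subUset !sub1set xS.
  move/subset_leq_card; rewrite cards2 xy Sr => /leq_trans/(_ r1); by rewrite ltnn.
Qed.
End EdgeSets.

(** * Transfer of complete subgraphs *)

Section Cliques.
Variables (R : realType) (X X' : mgraph).
Variables (phi : darc X -> darc X') (psi : darc X' -> darc X).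
Hypotheses (phiK : cancel phi psi) (psiK : cancel psi phi).
Hypothesis match_phi : zeta_match R phi.

Let match_psi : zeta_match R psi := zeta_match_sym phiK psiK match_phi.

Definition edge_map (Y Y' : mgraph) (f : darc Y -> darc Y') (e : edge Y) : edge Y' :=
  (f (e, true)).1.

Lemma edge_mapE (Y Y' : mgraph) (f : darc Y -> darc Y') a :
  zeta_match R f -> (f a).1 = edge_map f a.1.
Proof.
move=> mf; case: a => e [] //.
by rewrite -[(e, false)]/(ainv (e, true)) (match_ainv mf).
Qed.

Lemma edge_mapK : cancel (edge_map phi) (edge_map psi).
Proof. by move=> e; rewrite -edge_mapE // phiK. Qed.

Lemma edge_mapKV : cancel (edge_map psi) (edge_map phi).
Proof. by move=> e; rewrite -edge_mapE // psiK. Qed.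

(** The arcs between the vertices of a complete graph form a family in which any
    three vertices carry a triangle. Its image under [phi] satisfies the
    hypotheses of [common_vertices], which supplies the vertices of the image. *)
Lemma complete_on_transfer r (E : {set edge X}) :
  complete_on r (covered E) E ->
  complete_on r (covered (edge_map phi @: E)) (edge_map phi @: E).
Proof.
move=> KE; have [Er noloop inj_ends _] := KE.
set h := edge_map phi; pose I := {v | v \in covered E}.
(* An arc between two equal vertices is arbitrary; one exists as [x] is covered. *)
have /choice[arc arcP] (p : I * I) : exists a : darc X, p.1 != p.2 ->
    [/\ a.1 \in E, orig a = val p.1 & term a = val p.2].
  case: p => x y /=; have [xy|xy] := eqVneq x y.
    by have /bigcupP[e _ _] := valP x; exists (e, true).
  by have [a aP] := complete_arc KE (valP x) (valP y) xy; exists a.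
have arc_ends x y : x != y -> ends (arc (x, y)).1 = val @: [set x; y].
  by move=> /(arcP (x, y))[_ ax ay]; rewrite ends_darc ax ay imsetU !imset_set1.
have arc_inv x y : x != y -> arc (y, x) = ainv (arc (x, y)).
  move=> xy; have yx : y != x by rewrite eq_sym.
  have [xyE xy1 xy2] := arcP (x, y) xy; have [yxE yx1 yx2] := arcP (y, x) yx.
  have : (arc (y, x)).1 == (arc (x, y)).1.
    by apply/eqP/inj_ends; rewrite // !arc_ends // setUC.
  rewrite same_edge => /orP[/eqP eyx|/eqP //].
  by case/eqP: yx; apply: val_inj; rewrite -yx1 eyx xy1.
have arc_loop x y : x != y -> ~~ is_loop (arc (x, y)).
  by move=> xy; have [_ xy1 xy2] := arcP (x, y) xy; rewrite /is_loop xy1 xy2 eq_sym.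
have [|||w [inj_w wE]] := @common_vertices I X' (fun x y => phi (arc (x, y))).
- by move=> x y xy; rewrite arc_inv // (match_ainv match_phi).
- by move=> x y xy; rewrite (match_loop phiK psiK match_phi) arc_loop.
- move=> x y z /and3P[xy yz zx].
  apply: (match_triangle phiK psiK match_phi); rewrite ?arc_loop //.
  have [_ xy1 xy2] := arcP (x, y) xy; have [_ yz1 yz2] := arcP (y, z) yz.
  have [_ zx1 zx2] := arcP (z, x) zx.
  by rewrite /triangle xy1 xy2 yz1 yz2 zx1 zx2 !eqxx.
have hE x y : x != y -> ends (h (arc (x, y)).1) = w @: [set x; y].
  by move=> xy; rewrite /h -edge_mapE // wE // imsetU !imset_set1.
have all_arcs e : e \in E -> exists x y, x != y /\ e = (arc (x, y)).1.
  move=> eE; have eC : ends e \subset covered E by apply: finset.bigcup_sup.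
  have sC : src e \in covered E by apply: (fintype.subsetP eC); rewrite set21.
  have tC : tgt e \in covered E by apply: (fintype.subsetP eC); rewrite set22.
  pose x : I := exist (fun v => v \in covered E) _ sC.
  pose y : I := exist (fun v => v \in covered E) _ tC.
  have xy : x != y by exact: noloop.
  exists x, y; split=> //; have [aE _ _] := arcP (x, y) xy.
  by apply: inj_ends => //; rewrite arc_ends // imsetU !imset_set1.
have cov' : covered (h @: E) = w @: [set: I].
  apply/setP => v; apply/bigcupP/imsetP => [[f /imsetP[e /all_arcs]]|[x _ ->]].
    move=> [x [y [xy ->]]] ->; rewrite hE // => /imsetP[z _ ->].
    by exists z.
  have /bigcupP[e eE] := valP x.
  have [y [z [yz eyz]]] := all_arcs e eE.
  rewrite eyz arc_ends // (mem_imset _ _ val_inj) => x_yz.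
  exists (h e); first exact: imset_f.
  by rewrite eyz hE // imset_f.
split.
- by rewrite cov' card_imset // cardsT card_sig.
- move=> _ /imsetP[e /all_arcs[x [y [xy ->]]] ->].
  by rewrite loopless_ends hE // card_imset // cards2 xy.
- move=> _ _ /imsetP[e eE ->] /imsetP[f fE ->].
  have [x [y [xy exy]]] := all_arcs e eE; have [z [t [zt fzt]]] := all_arcs f fE.
  rewrite exy fzt !hE // => /(imset_inj inj_w) xyzt; congr h.
  by rewrite -exy -fzt; apply: inj_ends => //; rewrite exy fzt !arc_ends // xyzt.
- rewrite cov' => _ _ /imsetP[x _ ->] /imsetP[y _ ->].
  rewrite (inj_eq inj_w) => xy; have [aE _ _] := arcP (x, y) xy.
  by exists (h (arc (x, y)).1); rewrite ?imset_f // hE // imsetU !imset_set1.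
Qed.

(** An extra edge between the vertices of the image is parallel to one of its edges
    or is a loop at one of its vertices. Both are recognised by [phi]: the first
    forms a 2-cycle, the second is attached to a triangle, which takes three
    vertices. So the edge would come from an extra edge in [X]. *)
Lemma inside_transfer r (S : {set vert X}) :
  (2 <= r)%N -> (3 <= r)%N \/ loopless X' ->
  complete_on r S (inside S) ->
  inside (covered (edge_map phi @: inside S)) = edge_map phi @: inside S.
Proof.
move=> r2 r3 KS; have covS := covered_inside r2 KS.
have KS' : complete_on r (covered (edge_map phi @: inside S)) (edge_map phi @: inside S).
  by apply: complete_on_transfer; rewrite covS.
set E' := edge_map phi @: inside S in KS' *; set S' := covered E' in KS' *.
have backE a : a.1 \in E' -> orig (psi a) \in S /\ (psi a).1 \in inside S.
  move=> /imsetP[e eS ae]; have ee : (psi a).1 = e by rewrite edge_mapE // ae edge_mapK.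
  rewrite ee; split=> //; move: eS; rewrite inE -ee ends_darc => /fintype.subsetP; apply.
  by rewrite set21.
apply/setP => e; rewrite inE; apply/idP/idP => [eS'|]; last exact: finset.bigcup_sup.
suff : edge_map psi e \in inside S by move/(imset_f (edge_map phi)); rewrite edge_mapKV.
have srcS' : src e \in S' by apply: (fintype.subsetP eS'); rewrite set21.
have tgtS' : tgt e \in S' by apply: (fintype.subsetP eS'); rewrite set22.
pose a : darc X' := (e, true).
have [loop_e|noloop_e] := boolP (is_loop a); last first.
  (* [c] joins the same vertices as [a], in the opposite direction. *)
  have ts : tgt e != src e := noloop_e.
  have [c [cE co ct]] := complete_arc KS' tgtS' srcS' ts.
  have [ce|ce] := eqVneq a.1 c.1.
    by rewrite -[e]/a.1 ce -edge_mapE //; case: (backE c cE).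
  have noloop_c : ~~ is_loop c by rewrite /is_loop co ct eq_sym.
  have ac : a != ainv c by apply: contraNneq ce => ->.
  have : digon a c by rewrite /digon co ct !eqxx.
  rewrite -(match_digon psiK phiK match_psi) // => /andP[/eqP ac1 /eqP ac2].
  have : (psi c).1 \in inside S by case: (backE c cE).
  by rewrite -[e]/a.1 -edge_mapE // !inE !ends_darc ac1 ac2 setUC.
(* The triangle [a1 a2 a3] starts at the vertex of the loop. *)
case: r3 => [r3|noloop]; last by move: loop_e; rewrite /is_loop eq_sym (negbTE (noloop e)).
have [S'r _ _ _] := KS'.
have : (1 < #|S' :\ src e|)%N by move: r3; rewrite -S'r (cardsD1 (src e)) srcS'.
case/card_gt1P => y [z []]; rewrite !inE => /andP[ye yS'] /andP[ze zS'] yz.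
have ey : src e != y by rewrite eq_sym.
have [a1 [a1E a1o a1t]] := complete_arc KS' srcS' yS' ey.
have [a2 [a2E a2o a2t]] := complete_arc KS' yS' zS' yz.
have [a3 [a3E a3o a3t]] := complete_arc KS' zS' srcS' ze.
have t123 : triangle a1 a2 a3.
  by rewrite /triangle a1o a1t a2o a2t a3o a3t !eqxx.
have := @match_loop_at R _ _ psi phi psiK phiK match_psi a a1 a2 a3 loop_e t123.
rewrite /is_loop a1o a1t a2o a2t a3o a3t ye eq_sym yz eq_sym ze => /(_ isT isT isT erefl) ea.
have eS : orig (psi a) \in S.
  by move: ea; rewrite !inE => /or3P[] /eqP ->; apply: (backE _ _).1.
have := loop_e; rewrite -(match_loop psiK phiK match_psi) => /eqP lo.
by rewrite -[e]/a.1 -edge_mapE // ends_darc lo setUid sub1set.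
Qed.

Lemma s_e_complete_le r : (s_e (complete r) X <= s_e (complete r) X')%N.
Proof.
rewrite !s_eE -(card_imset _ (imset_inj (can_inj edge_mapK))).
apply/subset_leq_card/fintype.subsetP => _ /imsetP[E + ->].
rewrite !inE => /asboolP KE; apply/asboolP; exact: complete_on_transfer.
Qed.

Lemma s_v_complete_le r : (2 <= r)%N -> (3 <= r)%N \/ loopless X' ->
  (s_v (complete r) X <= s_v (complete r) X')%N.
Proof.
move=> r2 r3; rewrite !s_vE.
rewrite -(card_in_imset (f := fun S => covered (edge_map phi @: inside S))).
  apply/subset_leq_card/fintype.subsetP => _ /imsetP[S + ->].
  rewrite !inE => /asboolP KS; apply/asboolP; rewrite (inside_transfer r2 r3 KS).
  by apply: complete_on_transfer; rewrite (covered_inside r2 KS).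
move=> S T; rewrite !inE => /asboolP KS /asboolP KT ST.
rewrite -(covered_inside r2 KS) -(covered_inside r2 KT); congr covered.
apply: (imset_inj (can_inj edge_mapK)).
by rewrite -(inside_transfer r2 r3 KS) -(inside_transfer r2 r3 KT) ST.
Qed.
End Cliques.

Lemma zeta_equiv_s_e (R : realType) (X X' : mgraph) r :
  zeta_equiv R X X' -> s_e (complete r) X = s_e (complete r) X'.
Proof.
move=> [phi [[psi phiK psiK] phi_inv zetaE]].
have m : zeta_match R phi by split=> //; exists psi.
apply/eqP; rewrite eqn_leq (s_e_complete_le phiK psiK m).
exact: (s_e_complete_le psiK phiK (zeta_match_sym phiK psiK m)).
Qed.

Lemma zeta_equiv_s_v (R : realType) (X X' : mgraph) r :
  (2 <= r)%N -> (3 <= r)%N \/ loopless X /\ loopless X' ->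
  zeta_equiv R X X' -> s_v (complete r) X = s_v (complete r) X'.
Proof.
move=> r2 r3 [phi [[psi phiK psiK] phi_inv zetaE]].
have m : zeta_match R phi by split=> //; exists psi.
apply/eqP; rewrite eqn_leq (s_v_complete_le phiK psiK m) //=; last first.
  by case: r3 => [?|[]]; [left | right].
apply: (s_v_complete_le psiK phiK (zeta_match_sym phiK psiK m)) => //.
by case: r3 => [?|[]]; [left | right].
Qed.

Theorem corollary2 (R : realType) (n : nat) (n_gt0 : (0 < n)%N) :
  (forall r : nat, (3 <= r <= n)%N ->
    [/\ zeta_determined R (fun X => #|vert X| = n) (s_e (complete r)),
        zeta_determined R (fun X => #|vert X| = n) (s_v (complete r)) &
        forall X : mgraph, #|vert X| = n -> simple_graph X ->
          s_e (complete r) X = s_v (complete r) X])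
  /\ zeta_determined R (fun X => #|vert X| = n /\ loopless X) clique_number.
Proof.
split=> [r /andP[r3 _]|X X' [Xn lX] [X'n lX'] XX'].
  have r2 := ltnW r3; split=> [X X' _ _|X X' _ _|X _].
  - exact: zeta_equiv_s_e.
  - by apply: zeta_equiv_s_v => //; left.
  - exact: simple_s_e_s_v.
rewrite /clique_number Xn X'n; apply: eq_bigl => r.
have [r1|r2] := leqP r 1; last by rewrite (zeta_equiv_s_v r2 _ XX') //; right.
have rn : (r <= n)%N by rewrite -ltnS.
by rewrite !small_clique ?Xn ?X'n.
Qed.
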